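(* (Sticky active sets.) Let $d\in\{1,2,3\}$, $\Omega=(0,1)^d$, and consider the obstacle problem of minimizing $\int_\Omega \frac12|\nabla u|^2-fu\,\mathrm{d}x$ over $\{v\in H^1_0(\Omega): v\le\varphi \text{ a.e. in }\Omega\}$ with $f\equiv 20$ and $\varphi\equiv 1$. Suppose that the HIK algorithm is applied to a continuous piecewise linear (P1) finite element discretization of this problem on a fixed mesh $\mathcal{T}_h$, resulting in the system $$A\mathbf{u}+\boldsymbol{\lambda}=\mathbf{b},\qquad \boldsymbol{\lambda}-(\boldsymbol{\lambda}+\mathbf{u}-\boldsymbol{\varphi})_+=\mathbf{0}.$$ At the $k$-th HIK iteration, suppose further that $i\in\operatorname{int}\mathcal{A}^k$. Then $i\in\mathcal{A}^{k+1}$.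
   Context: Discretization: $\mathcal{T}_h$ is a simplicial mesh of $\Omega$ and $U_h$ is the continuous piecewise linear finite element space on $\mathcal{T}_h$ with the Dirichlet boundary conditions already incorporated. Every degree of freedom (dof) $i\in\{1,\dots,N\}$ is associated with a node $x_i\in\mathbb{R}^d$, and the basis functions $\phi_i\in U_h$ satisfy $\phi_i(x_j)=\delta_{ij}$. The discretized obstacle satisfies $\varphi_h=\varphi\equiv\bar\varphi>0$ (here $\bar\varphi=1$) and has coefficient vector $\boldsymbol{\varphi}\in\mathbb{R}^N$; the forcing satisfies $f\ge c_f>0$ (here $f\equiv 20$). $A_{ij}=\int_\Omega\nabla\phi_i\cdot\nabla\phi_j\,\mathrm{d}x$ is the stiffness matrix and $\mathbf{b}_i=\int_\Omega f\phi_i\,\mathrm{d}x$ is the load vector. $(\mathbf{v})_+$ is the componentwise maximum $\max(0,\mathbf{v}_i)$; $\mathbf{x}_{\mathcal{U}}$ denotes the subvector of $\mathbf{x}$ with indices in $\mathcal{U}$. HIK algorithm (primal-dual active set strategy with parameter $c=1$): $\mathbf{u}^0\in\mathbb{R}^N$ is given, $\boldsymbol{\lambda}^0=\mathbf{0}$, $\mathcal{A}^0=\emptyset$, $\mathcal{I}^0=\{1,\dots,N\}$. For $k\ge 0$, $(\mathbf{u}^{k+1},\boldsymbol{\lambda}^{k+1})$ is the unique pair with $A\mathbf{u}^{k+1}+\boldsymbol{\lambda}^{k+1}=\mathbf{b}$, $\mathbf{u}^{k+1}_{\mathcal{A}^k}=\boldsymbol{\varphi}_{\mathcal{A}^k}$,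 $\boldsymbol{\lambda}^{k+1}_{\mathcal{I}^k}=\mathbf{0}$; then $\mathcal{A}^{k+1}=\{i:\boldsymbol{\lambda}^{k+1}_i+\mathbf{u}^{k+1}_i-\boldsymbol{\varphi}_i>0\}$ and $\mathcal{I}^{k+1}=\{1,\dots,N\}\setminus\mathcal{A}^{k+1}$. Star patch: $\omega(x_i)=\bigcup\{K\in\mathcal{T}_h: x_i\in\overline K\}$. Strict interior of $\mathcal{A}^k$: the dof $i$ belongs to $\operatorname{int}\mathcal{A}^k$ if, for all $x_j\in\overline{\omega(x_i)}$, it holds that $j\in\mathcal{A}^k$.
   Formalization: In the definition of the strict interior, x_j ranges over all mesh nodes, including boundary nodes, which carry no dof and so are in no active set; a dof whose star patch touches a boundary node is never in int A^k (testing dof nodes only, the claim fails for d=1, h=1/8, u^0=0). *)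

(* Defs.v *)
From HB Require Import structures.
From mathcomp Require Import all_boot all_order all_algebra.
From mathcomp Require Import all_classical all_reals all_analysis.

Set Implicit Arguments.
Unset Strict Implicit.
Unset Printing Implicit Defensive.
Import Order.TTheory GRing.Theory Num.Theory.
Import numFieldNormedType.Exports.

Local Open Scope classical_set_scope.
Local Open Scope ring_scope.

(* The library has the product sigma-algebra on [d.-tuple T] but no d-fold
   product measure.  Lebesgue measure on R^d is built by recursion on d, as
   the image of the product measure on R * R^(d-1) under (x, t) |-> x :: t. *)

Section lebesgue_cons.
Context (R : realType) (d : nat).
Local Notation Rm := (measurableTypeR R).

Definition tcons (p : Rm * d.-tuple Rm) : d.+1.-tuple Rm :=
  [the d.+1.-tuple Rm of p.1 :: p.2].

Lemma measurable_tcons : measurable_fun setT tcons.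
Proof. exact: measurable_cons. Qed.

Variable mu : {sigma_finite_measure set (d.-tuple Rm) -> \bar R}.

Definition lebesgue_cons : set (d.+1.-tuple Rm) -> \bar R :=
  pushforward (@lebesgue_measure R \x mu)%E tcons.

Let measurable_pre (A : set (d.+1.-tuple Rm)) :
  measurable A -> measurable (tcons @^-1` A).
Proof. by move=> mA; rewrite -[_ @^-1` _]setTI; exact: measurable_tcons. Qed.

Let lebesgue_cons0 : lebesgue_cons set0 = 0%E.
Proof. by rewrite /lebesgue_cons /pushforward preimage_set0 measure0. Qed.

Let lebesgue_cons_ge0 A : (0 <= lebesgue_cons A)%E.
Proof. by rewrite /lebesgue_cons /pushforward; exact: measure_ge0. Qed.

Let lebesgue_cons_sigma_additive : semi_sigma_additive lebesgue_cons.
Proof.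
move=> F mF tF mUF; rewrite /lebesgue_cons /pushforward preimage_bigcup.
apply: measure_semi_sigma_additive.
- by move=> n; exact: measurable_pre.
- apply/trivIsetP => /= i j _ _ ij; rewrite -preimage_setI.
  by move/trivIsetP : tF => /(_ _ _ _ _ ij) ->//; rewrite preimage_set0.
- by rewrite -preimage_bigcup; exact: measurable_pre.
Qed.

HB.instance Definition _ := isMeasure.Build _ _ _ lebesgue_cons
  lebesgue_cons0 lebesgue_cons_ge0 lebesgue_cons_sigma_additive.

Lemma lebesgue_consE (A : set Rm) (B : set (d.-tuple Rm)) :
  measurable A -> measurable B ->
  lebesgue_cons [set t | A (thead t) /\ B [tuple of behead t]] =
    (lebesgue_measure A * mu B)%E.
Proof.
move=> mA mB; rewrite -product_measure1E//; congr (_ \x _)%E.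
apply/seteqP; split=> -[x t] /=; rewrite theadE /=.
  by move=> [Ax]; rewrite (_ : [tuple of _] = t)//; exact: val_inj.
by move=> [Ax Bt]; split=> //; rewrite (_ : [tuple of _] = t)//; exact: val_inj.
Qed.

Let lebesgue_cons_sigma_finite : sigma_finite setT lebesgue_cons.
Proof.
have /sigma_finiteP[F [TF ndF Foo]] := sigma_finiteT (@lebesgue_measure R).
have /sigma_finiteP[G [TG ndG Goo]] := sigma_finiteT mu.
exists (fun n => [set t | F n (thead t) /\ G n [tuple of behead t]]).
  apply/seteqP; split=> // t _.
  have [i _ Fi] : (\bigcup_i F i) (thead t) by rewrite -TF.
  have [j _ Gj] : (\bigcup_i G i) [tuple of behead t] by rewrite -TG.
  exists (maxn i j) => //; split.
    by move/subsetPset : (ndF _ _ (leq_maxl i j)); exact.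
  by move/subsetPset : (ndG _ _ (leq_maxr i j)); exact.
move=> k; have [mF Fk] := Foo k; have [mG Gk] := Goo k; split.
  rewrite [X in measurable X](_ : _ =
    ((@thead d Rm) @^-1` F k) `&`
    ((fun t : d.+1.-tuple Rm => [tuple of behead t]) @^-1` G k))//.
  apply: measurableI.
    by rewrite -[_ @^-1` _]setTI; exact: (@measurable_tnth _ Rm d.+1 ord0).
  by rewrite -[_ @^-1` _]setTI; exact: measurable_behead.
by rewrite lebesgue_consE// lte_mul_pinfty// ge0_fin_numE.
Qed.

HB.instance Definition _ := Measure_isSigmaFinite.Build _ _ _ lebesgue_cons
  lebesgue_cons_sigma_finite.

End lebesgue_cons.

Fixpoint lebesgue_tuple (R : realType) (d : nat) :
    {sigma_finite_measure set (d.-tuple (measurableTypeR R)) -> \bar R} :=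
  if d is d'.+1 then lebesgue_cons (lebesgue_tuple R d')
  else \d_ [tuple of [::]].

Lemma lebesgue_tuple_box (R : realType) (d : nat)
    (I : 'I_d -> set (measurableTypeR R)) :
  (forall k, measurable (I k)) ->
  lebesgue_tuple R d [set t | forall k, I k (tnth t k)] =
    (\prod_(k < d) lebesgue_measure (I k))%E.
Proof.
elim: d I => [|d IH] I mI.
  rewrite big_ord0 /= diracE mem_set//= => -[] //.
rewrite big_ord_recl -IH// -lebesgue_consE//; last first.
  rewrite [X in measurable X](_ : _ =
    \bigcap_(k in [set: 'I_d]) ((@tnth _ _)^~ k @^-1` I (lift ord0 k))).
    apply: fin_bigcap_measurable => // k _; rewrite -[_ @^-1` _]setTI.
    exact: measurable_tnth.
  by apply/seteqP; split=> t /= It k; [move=> _|]; exact: It.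
congr (lebesgue_cons _ _); apply/seteqP; split=> t /=.
  move=> It; split=> [|k]; first exact: It.
  by have := It (lift ord0 k); rewrite [in X in X -> _](tuple_eta t) tnthS.
move=> [I0 It] k; have [j ->|->//] := unliftP ord0 k.
by rewrite (tuple_eta t) tnthS; exact: It.
Qed.

Definition rv_of_tuple (R : realType) (d : nat)
    (t : d.-tuple (measurableTypeR R)) : 'rV[R]_d :=
  \row_k (tnth t k : R).

Definition integral_rv (R : realType) (d : nat) (D : set 'rV[R]_d)
    (F : 'rV[R]_d -> R) : R :=
  \int[lebesgue_tuple R d]_(t in @rv_of_tuple R d @^-1` D) F (rv_of_tuple t).

Definition unit_cube (R : realType) (d : nat) : set 'rV[R]_d :=
  [set x | forall k : 'I_d, 0 < x 0 k < 1].

(* A simplex is given by the set of the indices of its vertices x i. *)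

Definition closed_simplex (R : realType) (d M : nat) (x : 'I_M -> 'rV[R]_d)
    (S : {set 'I_M}) : set 'rV[R]_d :=
  [set y | exists a : 'I_M -> R, [/\ forall i, i \in S -> 0 <= a i,
     \sum_(i in S) a i = 1 & y = \sum_(i in S) a i *: x i]].

Definition open_simplex (R : realType) (d M : nat) (x : 'I_M -> 'rV[R]_d)
    (S : {set 'I_M}) : set 'rV[R]_d :=
  [set y | exists a : 'I_M -> R, [/\ forall i, i \in S -> 0 < a i,
     \sum_(i in S) a i = 1 & y = \sum_(i in S) a i *: x i]].

Definition affinely_independent (R : realType) (d M : nat)
    (x : 'I_M -> 'rV[R]_d) (S : {set 'I_M}) : Prop :=
  forall a : 'I_M -> R, \sum_(i in S) a i = 0 ->
    \sum_(i in S) a i *: x i = 0 -> forall i, i \in S -> a i = 0.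

(* A conforming simplicial mesh of Omega: two closed elements meet in the
   (possibly empty) face spanned by their common vertices.  The nodes are all
   the vertices of the mesh, those on the boundary of Omega included. *)
Record mesh (R : realType) (d : nat) (Omega : set 'rV[R]_d) := Mesh {
  nb_nodes : nat;
  node : 'I_nb_nodes -> 'rV[R]_d;
  cells : {set {set 'I_nb_nodes}};
  node_inj : injective node;
  node_in_cell : forall i, exists2 K, K \in cells & i \in K;
  card_cell : forall K, K \in cells -> #|K| = d.+1;
  cell_nondegenerate : forall K, K \in cells -> affinely_independent node K;
  cells_cover :
    closure Omega = \bigcup_(K in [set` cells]) closed_simplex node K;
  cells_conforming : forall K L, K \in cells -> L \in cells ->
    closed_simplex node K `&` closed_simplex node L =
    closed_simplex node (K :&: L) }.

Arguments node {R d Omega} m i.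
Arguments cells {R d Omega} m.

Section finite_elements.
Context (R : realType) (d : nat) (Omega : set 'rV[R]_d) (Th : mesh Omega).

(* Continuous piecewise affine functions vanishing on the boundary of the open
   set Omega; only the values on the closure of Omega are meaningful. *)
Definition P1_space : set ('rV[R]_d -> R) :=
  [set v | [/\ {within closure Omega, continuous v},
     forall K, K \in cells Th -> exists (c : R) (g : 'rV[R]_d),
       forall y, open_simplex (node Th) K y ->
         v y = c + \sum_k g 0 k * y 0 k
   & forall y, closure Omega y -> ~ Omega y -> v y = 0]].

(* The degrees of freedom 'I_N number the nodes lying in Omega. *)
Definition dof_numbering (N : nat) (dof : 'I_N -> 'I_(nb_nodes Th)) : Prop :=
  injective dof /\
  forall j, Omega (node Th j) <-> exists i, dof i = j.

Definition nodal_basis (N : nat) (dof : 'I_N -> 'I_(nb_nodes Th))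
    (phi : 'I_N -> 'rV[R]_d -> R) : Prop :=
  forall i, P1_space (phi i) /\
    forall j, phi i (node Th (dof j)) = (i == j)%:R.

(* The weak gradient of a P1 function is only defined up to null sets; we take
   the classical one inside the elements and 0 elsewhere. *)
Definition gradient (v : 'rV[R]_d -> R) (y : 'rV[R]_d) : 'rV[R]_d :=
  if y \in \bigcup_(K in [set` cells Th]) open_simplex (node Th) K
  then \row_k 'D_(delta_mx 0 k) v y else 0.

Definition stiffness (N : nat) (phi : 'I_N -> 'rV[R]_d -> R) : 'M[R]_N :=
  \matrix_(i, j) integral_rv Omega (fun y =>
    \sum_k gradient (phi i) y 0 k * gradient (phi j) y 0 k).

Definition load (N : nat) (f : 'rV[R]_d -> R)
    (phi : 'I_N -> 'rV[R]_d -> R) : 'cV[R]_N :=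
  \col_i integral_rv Omega (fun y => f y * phi i y).

Definition obstacle_coefs (N : nat) (obst : 'rV[R]_d -> R)
    (dof : 'I_N -> 'I_(nb_nodes Th)) : 'cV[R]_N :=
  \col_i obst (node Th (dof i)).

Definition star (j : 'I_(nb_nodes Th)) : set 'rV[R]_d :=
  \bigcup_(K in [set K | K \in cells Th /\
      closure (open_simplex (node Th) K) (node Th j)])
    open_simplex (node Th) K.

(* Nodes on the boundary of Omega carry no degree of freedom, hence belong to
   no active set: a degree of freedom whose star has a vertex on the boundary
   is never in the strict interior. *)
Definition strict_interior (N : nat) (dof : 'I_N -> 'I_(nb_nodes Th))
    (Act : {set 'I_N}) (i : 'I_N) : Prop :=
  forall j, closure (star (dof i)) (node Th j) ->
    exists2 l, l \in Act & dof l = j.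

End finite_elements.

(* Iterates u k, lam k and active sets Act k of the HIK algorithm; the inactive
   set is the complement of Act k. *)
Definition HIK_iterates (R : realType) (N : nat) (A : 'M[R]_N)
    (b obst u0 : 'cV[R]_N) (u lam : nat -> 'cV[R]_N)
    (Act : nat -> {set 'I_N}) : Prop :=
  [/\ u 0%N = u0, lam 0%N = 0, Act 0%N = finset.set0 &
   forall k : nat,
     [/\ A *m u k.+1 + lam k.+1 = b,
         forall i, i \in Act k -> u k.+1 i 0 = obst i 0,
         forall i, i \notin Act k -> lam k.+1 i 0 = 0
       & Act k.+1 =
           finset (fun i => 0 < lam k.+1 i 0 + u k.+1 i 0 - obst i 0)]].

(* Main.v *)
Require Import Defs.
From HB Require Import structures.
From mathcomp Require Import all_boot all_order all_algebra.
From mathcomp Require Import all_classical all_reals all_analysis.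
From mathcomp Require Import ring lra.

Set Implicit Arguments.
Unset Strict Implicit.
Unset Printing Implicit Defensive.
Import Order.TTheory GRing.Theory Num.Theory.
Import numFieldNormedType.Exports.

Local Open Scope classical_set_scope.
Local Open Scope ring_scope.

(** Write A for the stiffness matrix, b for the load vector and u, lam for the
new iterates.  Row i of the first equation of the algorithm reads
lam_i = b_i - (A u)_i, and A u is the vector of the integrals of
grad phi_i . grad w over the cube, with w = sum_j u_j phi_j.  The integrand
vanishes outside the elements K having the node of i as a vertex.  When i lies
in the strict interior of the old active set, all the vertices of such a K are
degrees of freedom of that set, where u takes the value 1 of the obstacle: w is
then the affine function equal to 1 at the d + 1 vertices of K, so its gradient
vanishes.  Hence (A u)_i = 0 (stiffness_row_cst), and lam_i = b_i is
positive because a hat function is nonnegative, and positive on an open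
set (load_gt0).  As u_i = 1, this gives lam_i + u_i - 1 > 0, which is the
membership of i in the new active set.

The argument rests on the geometry of one simplex.  The barycentric coordinates
of a nondegenerate simplex are affine functions (barycentric_coords), so that an
open (closed) simplex is a finite intersection of open (closed) half-spaces:
this makes the open simplex open, which gives sense to classical gradients
inside it, and makes both simplices measurable.  Continuity propagates the
affine expression of a P1 function from an open simplex to the closed one
(P1_affine), hence relates it to the nodal values.  Gradients of P1
functions are thus constant on each element, which yields the integrability used
to exchange sums and integrals. *)

(** * Affine functions *)

Section affine_functions.
Context (R : realType) (d : nat).
Implicit Types (c : R) (g y z : 'rV[R]_d).

Definition affine c g y : R := c + \sum_k g 0 k * y 0 k.

Lemma affine_comb (I : finType) (S : {set I}) (a : I -> R) (x : I -> 'rV[R]_d)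
    c g :
  \sum_(i in S) a i = 1 ->
  affine c g (\sum_(i in S) a i *: x i) = \sum_(i in S) a i * affine c g (x i).
Proof.
move=> a1; rewrite /affine.
under [RHS]eq_bigr do rewrite mulrDr.
rewrite big_split/= -mulr_suml a1 mul1r; congr (_ + _).
under [RHS]eq_bigr do rewrite mulr_sumr.
rewrite exchange_big/=; apply: eq_bigr => k _.
rewrite summxE mulr_sumr; apply: eq_bigr => i _.
by rewrite mxE mulrCA.
Qed.

Lemma affine_line c g y z (h : R) :
  affine c g (h *: z + y) = h * \sum_k g 0 k * z 0 k + affine c g y.
Proof.
rewrite /affine addrCA; congr (_ + _).
rewrite mulr_sumr -big_split/=; apply: eq_bigr => k _.
by rewrite !mxE mulrDr mulrCA.
Qed.

Lemma sum_mul_delta g k : \sum_l g 0 l * (delta_mx 0 k : 'rV[R]_d) 0 l = g 0 k.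
Proof.
rewrite (bigD1 k)//= mxE !eqxx mulr1 big1 ?addr0// => l lk.
by rewrite mxE (negbTE lk) andbF mulr0.
Qed.

Lemma continuous_affine c g : continuous (affine c g).
Proof.
have cs : continuous (fun y => \sum_k g 0 k * y 0 k).
  apply: continuous_big => [|k _ z]; first exact: add_continuous.
  exact: (cvgM (cvg_cst _) (@coord_continuous R 1 d 0 k z)).
by move=> y; exact: (cvgD (cvg_cst c) (cs y)).
Qed.

Lemma measurable_affine c g (D : set (d.-tuple (measurableTypeR R))) :
  measurable_fun D (fun t => affine c g (rv_of_tuple t)).
Proof.
apply: measurable_funS (@subsetT _ D) _ => //.
apply: measurable_realfun.measurable_funD; first exact: measurable_cst.
apply: measurable_sum => k; apply: measurable_realfun.measurable_funM.
  exact: measurable_cst.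
under eq_fun do rewrite mxE.
exact: measurable_tnth.
Qed.

End affine_functions.

(** * Nondegenerate simplices *)

Section simplices.
Context (R : realType) (d M : nat) (x : 'I_M -> 'rV[R]_d) (K : {set 'I_M}).
Hypotheses (cardK : #|K| = d.+1) (indepK : affinely_independent x K).

(** The matrix V with rows (1, x v), for v in K, is square and affine
independence of the vertices is the triviality of its left kernel.  The
coordinates of y are the coefficients expressing (1, y) in the rows of V, that
is (1, y) V^-1: the first column of V gives their sum, the others give y.  The
pseudo-inverse avoids a cast between the equal dimensions #|K| and 1 + d. *)
Lemma barycentric_coords : exists (c : 'I_M -> R) (g : 'I_M -> 'rV[R]_d),
  forall y, \sum_(v in K) affine (c v) (g v) y = 1 /\
            y = \sum_(v in K) affine (c v) (g v) y *: x v.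
Proof.
pose V : 'M[R]_(#|K|, 1 + d) :=
  \matrix_i row_mx (1%:M : 'M[R]_1) (x (enum_val i)).
have M11 : (1%:M : 'M[R]_1) 0 0 = 1 by rewrite mxE.
have Vl i : V i (lshift d 0) = 1 by rewrite mxE row_mxEl M11.
have Vr i k : V i (rshift 1 k) = x (enum_val i) 0 k by rewrite mxE row_mxEr.
have [v0 v0K] : exists v, v \in K.
  by apply/set0Pn; rewrite -card_gt0 cardK.
have fullV : row_full V.
  suff : row_free V by rewrite /row_free /row_full => /eqP ->; rewrite cardK.
  apply: inj_row_free => w w0.
  pose a v := w 0 (enum_rank_in v0K v).
  have aE i : a (enum_val i) = w 0 i by rewrite /a enum_valK_in.
  have wV j : \sum_i w 0 i * V i j = 0.
    by move/matrixP : w0 => /(_ 0 j); rewrite !mxE.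
  apply/rowP => i; rewrite mxE -aE; apply: indepK; last exact: enum_valP.
    rewrite (big_enum_val (A := mem K))/= -[RHS](wV (lshift d 0)).
    by apply: eq_bigr => j _; rewrite aE Vl mulr1.
  rewrite (big_enum_val (A := mem K))/=; apply/rowP => k.
  rewrite summxE [RHS]mxE -[RHS](wV (rshift 1 k)).
  by apply: eq_bigr => j _; rewrite mxE aE Vr.
pose P := pinvmx V; pose r := enum_rank_in v0K.
pose b (y : 'rV[R]_d) := row_mx (1%:M : 'M[R]_1) y *m P.
exists (fun v => P (lshift d 0) (r v)),
  (fun v => \row_k P (rshift 1 k) (r v)) => y.
have bE v : affine (P (lshift d 0) (r v)) (\row_k P (rshift 1 k) (r v)) y =
    b y 0 (r v).
  rewrite /b [RHS]mxE big_split_ord/= big_ord1 row_mxEl M11 mul1r.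
  congr (_ + _); apply: eq_bigr => k _.
  by rewrite row_mxEr [in LHS]mxE mulrC.
have bV : b y *m V = row_mx 1%:M y by rewrite /b mulmxKpV// submx_full.
split.
  under eq_bigr do rewrite bE.
  rewrite (big_enum_val (A := mem K))/=.
  transitivity ((b y *m V) 0 (lshift d 0)); last by rewrite bV row_mxEl M11.
  rewrite [RHS]mxE; apply: eq_bigr => i _.
  by rewrite /r enum_valK_in Vl mulr1.
under eq_bigr do rewrite bE.
rewrite (big_enum_val (A := mem K))/=; apply/rowP => k.
transitivity ((b y *m V) 0 (rshift 1 k)); first by rewrite bV row_mxEr.
rewrite [LHS]mxE summxE; apply: eq_bigr => i _.
by rewrite /r enum_valK_in Vr [RHS]mxE.
Qed.

Lemma barycentric_uniq (a b : 'I_M -> R) :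
  \sum_(v in K) a v = 1 -> \sum_(v in K) b v = 1 ->
  \sum_(v in K) a v *: x v = \sum_(v in K) b v *: x v ->
  {in K, a =1 b}.
Proof.
move=> a1 b1 ab v vK; apply/eqP; rewrite -subr_eq0; apply/eqP.
apply: (indepK (a := fun v => a v - b v)) => //.
  by rewrite sumrB a1 b1 subrr.
under eq_bigr do rewrite scalerBl.
by rewrite sumrB ab subrr.
Qed.

(** The coordinates in barycentric_coords are the only ones, so membership in
a simplex is a sign condition on fixed affine functions. *)
Lemma simplex_halfspaces : exists (c : 'I_M -> R) (g : 'I_M -> 'rV[R]_d),
  open_simplex x K =
    \bigcap_(v in [set` K]) [set y | 0 < affine (c v) (g v) y] /\
  closed_simplex x K =
    \bigcap_(v in [set` K]) [set y | 0 <= affine (c v) (g v) y].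
Proof.
have [c [g cg]] := barycentric_coords; exists c, g.
split; apply/seteqP; split=> y /=.
- move=> [a [a0 a1 ya]] v vK /=; have [b1 yb] := cg y.
  rewrite (barycentric_uniq b1 a1 _ vK) ?a0//.
  by rewrite -yb.
- move=> b0; have [b1 yb] := cg y.
  by exists (fun v => affine (c v) (g v) y); split.
- move=> [a [a0 a1 ya]] v vK /=; have [b1 yb] := cg y.
  rewrite (barycentric_uniq b1 a1 _ vK) ?a0//.
  by rewrite -yb.
- move=> b0; have [b1 yb] := cg y.
  by exists (fun v => affine (c v) (g v) y); split.
Qed.

Lemma open_open_simplex : open (open_simplex x K).
Proof.
have [c [g [-> _]]] := simplex_halfspaces.
rewrite openE => y /= yK.
have : \forall z \near y, forall v, v \in K -> 0 < affine (c v) (g v) z.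
  apply: (@filter_forall _ _ _ _ (nbhs_filter y)) => v.
  have [vK|_] := boolP (v \in K); last by apply: nearW.
  have := cvgr_gt _ (@continuous_affine R d (c v) (g v) y) _ (yK v vK).
  move=> /(_ (nbhs_filter y)).
  by apply: (@filterS _ _ (nbhs_filter y)) => z.
by apply: (@filterS _ _ (nbhs_filter y)) => z.
Qed.

Lemma measurable_open_simplex :
  measurable (@rv_of_tuple R d @^-1` open_simplex x K).
Proof.
have [c [g [-> _]]] := simplex_halfspaces.
rewrite preimage_bigcap; apply: fin_bigcap_measurable => // v _.
rewrite -[X in measurable X]setTI.
apply: (measurable_affine (c v) (g v) measurableT (Y := [set r | 0 < r])).
by rewrite -set_itvoy; exact: measurable_itv.
Qed.

Lemma measurable_closed_simplex :
  measurable (@rv_of_tuple R d @^-1` closed_simplex x K).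
Proof.
have [c [g [_ ->]]] := simplex_halfspaces.
rewrite preimage_bigcap; apply: fin_bigcap_measurable => // v _.
rewrite -[X in measurable X]setTI.
apply: (measurable_affine (c v) (g v) measurableT (Y := [set r | 0 <= r])).
by rewrite -set_itvcy; exact: measurable_itv.
Qed.

(** Every point, even outside the simplex, is an affine combination of the
d + 1 vertices, so the affine function is constant on the whole space. *)
Lemma affine_cst_vertices (c s : R) (g : 'rV[R]_d) :
  (forall v, v \in K -> affine c g (x v) = s) -> g = 0.
Proof.
move=> gs; have [b [B bB]] := barycentric_coords.
have cst y : affine c g y = s.
  have [b1 yb] := bB y; rewrite [in LHS]yb affine_comb//.
  by under eq_bigr => v vK do rewrite gs//; rewrite -mulr_suml b1 mul1r.
apply/rowP => k; rewrite mxE -[LHS]sum_mul_delta.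
have := affine_line c g 0 (delta_mx 0 k) 1.
by rewrite !cst mul1r => /(congr1 (fun r => r - s)); rewrite addrK subrr.
Qed.

Lemma barycenter_open_simplex :
  exists z, open_simplex x K z.
Proof.
exists (\sum_(v in K) d.+1%:R^-1 *: x v), (fun=> d.+1%:R^-1); split=> //.
by rewrite sumr_const cardK -[LHS]mulr_natr mulVf// pnatr_eq0.
Qed.

Lemma open_simplex_subset : open_simplex x K `<=` closed_simplex x K.
Proof. by move=> y [a [a0 a1 ya]]; exists a; split=> // v vK; exact/ltW/a0. Qed.

Lemma open_simplex_segment y z (t : R) : closed_simplex x K y ->
  open_simplex x K z -> 0 < t -> t <= 1 -> open_simplex x K (t *: (z - y) + y).
Proof.
move=> [a [a0 a1 ->]] [b [b0 b1 ->]] t0 t1.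
exists (fun v => t * (b v - a v) + a v); split.
- move=> v vK; rewrite mulrBr -addrA [- _ + _]addrC.
  rewrite -[X in X - _]mul1r -mulrBl ltr_pwDl ?mulr_gt0 ?b0//.
  by rewrite mulr_ge0 ?subr_ge0// a0.
- by rewrite big_split/= -mulr_sumr sumrB a1 b1 subrr mulr0 add0r.
- rewrite -sumrB scaler_sumr -big_split/=; apply: eq_bigr => v vK.
  by rewrite -scalerBl scalerA -scalerDl.
Qed.

(** Together with open_simplex_segment, this approaches a point y of the closed
simplex from its interior. *)
Lemma cvg_segment (y z : 'rV[R]_d) :
  (t *: (z - y) + y) @[t --> (0:R)^'+] --> y.
Proof.
rewrite -[X in _ --> X]add0r -[in X in _ --> X](scale0r (z - y)).
apply: cvgD; last exact: cvg_cst.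
apply: cvgZl.
exact: cvg_at_right_filter.
Qed.

Lemma closed_simplex_subset :
  closed_simplex x K `<=` closure (open_simplex x K).
Proof.
move=> y yK; have [z zK] := barycenter_open_simplex.
apply: (@closed_cvg _ _ _ _ (fun t : R => t *: (z - y) + y) _
  (@closed_closure _ (open_simplex x K)) _ _ (@cvg_segment y z)).
near=> t; apply: subset_closure; apply: open_simplex_segment => //.
by near: t; apply: nbhs_right_le.
Unshelve. all: by end_near. Qed.

Lemma vertex_closed_simplex v : v \in K -> closed_simplex x K (x v).
Proof.
move=> vK; exists (fun w => (w == v)%:R); split.
- by move=> w _; rewrite ler0n.
- by rewrite (bigD1 v)//= eqxx big1 ?addr0// => w /andP[_ /negbTE ->].
- rewrite (bigD1 v)//= eqxx scale1r big1 ?addr0// => w /andP[_ /negbTE ->].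
  by rewrite scale0r.
Qed.

End simplices.

(** * Measure and integration *)

(** The sets C i may overlap, which suits closed elements sharing faces. *)
Lemma measurable_fun_cover d1 d2 (T1 : measurableType d1)
    (T2 : measurableType d2) (I : finType) (P : {set I}) (C : I -> set T1)
    (F : I -> T1 -> T2) (f : T1 -> T2) (D : set T1) :
  (forall i, i \in P -> measurable (C i)) ->
  (forall i, i \in P -> measurable_fun setT (F i)) ->
  (forall i t, i \in P -> C i t -> f t = F i t) ->
  D `<=` \bigcup_(i in [set` P]) C i -> measurable_fun D f.
Proof.
move=> mC mF fF DC mD Y mY.
rewrite [X in measurable X](_ : _ =
    \bigcup_(i in [set` P]) ((D `&` C i) `&` F i @^-1` Y)).
  apply: fin_bigcup_measurable => // i iP; apply: measurableI.
    by apply: measurableI => //; exact: mC.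
  by rewrite -[X in measurable X]setTI; exact: mF.
apply/seteqP; split=> t /=.
  move=> [Dt Yt]; have [i iP Cit] := DC _ Dt.
  by exists i => //; split=> //=; rewrite -(fF i).
by move=> [i iP [[Dt Cit]]]; rewrite /= -(fF i t iP Cit).
Qed.

Lemma Rintegral_sum d (T : measurableType d) (R : realType)
    (mu : {measure set T -> \bar R}) (D : set T) (I : Type) (s : seq I)
    (f : I -> T -> R) :
  measurable D -> (forall i, mu.-integrable D (EFin \o f i)) ->
  \int[mu]_(t in D) (\sum_(i <- s) f i t) =
  \sum_(i <- s) \int[mu]_(t in D) f i t.
Proof.
move=> mD If; elim: s => [|i s IH].
  rewrite big_nil -[RHS](mul0r (fine (mu D))) -Rintegral_cst//.
  by apply: eq_Rintegral => t _; rewrite big_nil.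
rewrite big_cons -IH -RintegralD//; last first.
  have := integrable_sum mD s (P := xpredT) (h := fun i => EFin \o f i)
    (fun i _ => If i).
  by congr (integrable _ _ _); apply/funext => t /=; rewrite -sumEFin.
by apply: eq_Rintegral => t _; rewrite big_cons.
Qed.

Section unit_cube.
Context (R : realType) (d : nat).
Local Notation mu := (lebesgue_tuple R d).

Lemma closure_unit_cube (y : 'rV[R]_d) :
  closure (@unit_cube R d) y -> forall k, 0 <= y 0 k <= 1.
Proof.
move=> cy k.
have : closed [set z : 'rV[R]_d | `[0, 1]%classic (z 0 k)].
  apply: closed_comp; last exact: itv_closed.
  by move=> z _; exact: coord_continuous.
move=> /closure_id cE.
have : [set z : 'rV[R]_d | `[0, 1]%classic (z 0 k)] y.
  rewrite cE; apply: closure_subset cy => z /= z01.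
  by have /andP[z0 z1] := z01 k; rewrite in_itv/= !ltW.
by rewrite /= in_itv.
Qed.

Lemma preimage_unit_cubeE : @rv_of_tuple R d @^-1` @unit_cube R d =
  [set t | forall k, (`]0, 1[%classic : set (measurableTypeR R)) (tnth t k)].
Proof.
by apply/seteqP; split=> t /= H k; have := H k; rewrite mxE in_itv.
Qed.

Lemma measurable_box (I : 'I_d -> set (measurableTypeR R)) :
  (forall k, measurable (I k)) ->
  measurable [set t : d.-tuple (measurableTypeR R) | forall k, I k (tnth t k)].
Proof.
move=> mI; rewrite [X in measurable X](_ : _ =
    \bigcap_(k in [set: 'I_d]) ((@tnth _ _)^~ k @^-1` I k)).
  apply: fin_bigcap_measurable => // k _; rewrite -[_ @^-1` _]setTI.
  exact: measurable_tnth.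
by apply/seteqP; split=> t /= It k; [move=> _|]; exact: It.
Qed.

Lemma measurable_unit_cube : measurable (@rv_of_tuple R d @^-1` @unit_cube R d).
Proof.
rewrite preimage_unit_cubeE; apply: (@measurable_box (fun=> `]0, 1[%classic)).
by move=> k; exact: measurable_itv.
Qed.

Lemma lebesgue_unit_cube : mu (@rv_of_tuple R d @^-1` @unit_cube R d) = 1%E.
Proof.
rewrite preimage_unit_cubeE.
rewrite (lebesgue_tuple_box (I := fun=> `]0, 1[%classic)); last first.
  by move=> k; exact: measurable_itv.
rewrite big1// => k _; rewrite lebesgue_measure_itv/= lte_fin ltr01.
by rewrite -EFinB subr0.
Qed.

(** Balls of the sup norm are boxes, whose measure is a product of lengths; this
is what gives positive measure to neighbourhoods. *)
Lemma nbhs_box (y : 'rV[R]_d) (U : set 'rV[R]_d) : nbhs y U ->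
  exists2 B, [/\ measurable B, B `<=` @rv_of_tuple R d @^-1` U & (mu B < +oo)%E]
    & (0 < mu B)%E.
Proof.
move=> /nbhs_ballP[e /= e0 eU].
pose I k : set (measurableTypeR R) := `]y 0 k - e, y 0 k + e[%classic.
have muI k : lebesgue_measure (I k) = (e + e)%:E.
  rewrite lebesgue_measure_itv/= lte_fin ltrBlDr -addrA ltrDl addr_gt0//.
  by rewrite -EFinB; congr (_%:E); ring.
have muB : mu [set t | forall k, I k (tnth t k)] = (\prod_(k < d) (e + e))%:E.
  rewrite (lebesgue_tuple_box (I := I)); last first.
    by move=> k; exact: measurable_itv.
  by rewrite -prodEFin; apply: eq_bigr => k _; exact: muI.
exists [set t | forall k, I k (tnth t k)]; last first.
  by rewrite muB lte_fin prodr_gt0// => k _; rewrite addr_gt0.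
split; last by rewrite muB ltry.
  by apply: (@measurable_box I) => k; exact: measurable_itv.
move=> t /= It; apply: eU; split=> // i k; rewrite (ord1 i) /ball/= mxE.
by have := It k; rewrite /I/= in_itv/= -ltr_distl distrC.
Qed.

End unit_cube.

(** * Continuous piecewise affine functions *)

Lemma derive_affine_near (R : realType) (d : nat) (v : 'rV[R]_d -> R)
    (y w : 'rV[R]_d) (c : R) (g : 'rV[R]_d) :
  (\forall z \near y, v z = affine c g z) ->
  'D_w v y = \sum_k g 0 k * w 0 k.
Proof.
move=> vE; apply: (@lim_near_cst R (@norm_hausdorff _ _)).
have hy : (h *: w + y) @[h --> (0:R)^'] --> y.
  rewrite -[X in _ --> X]add0r -[in X in _ --> X](scale0r w).
  apply: cvgD; last exact: cvg_cst.
  apply: cvgZr_tmp.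
  exact: cvg_within.
have vy := nbhs_singleton vE.
near=> h; rewrite /= vy (_ : v (h *: w + y) = affine c g (h *: w + y)).
  rewrite affine_line addrK; have h0 : h != 0 by near: h; exact: nbhs_dnbhs_neq.
  by rewrite /GRing.scale/= mulKf.
by near: h; exact: (hy _ vE).
Unshelve. all: by end_near. Qed.

Section P1_functions.
Context (R : realType) (d : nat) (Omega : set 'rV[R]_d) (Th : mesh Omega).
Implicit Types (v : 'rV[R]_d -> R) (K : {set 'I_(nb_nodes Th)}).

Lemma closed_simplex_closure K : K \in cells Th ->
  closed_simplex (node Th) K `<=` closure Omega.
Proof. by move=> KT y yK; rewrite (cells_cover Th); exists K. Qed.

(** By definition v is affine on the open element.  A point y of the closed
element is the limit of a segment lying in the open one, along which both v, by
continuity on the closure of Omega, and the affine function converge to their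
values at y. *)
Lemma P1_affine v K : P1_space Th v -> K \in cells Th ->
  exists c g, forall y, closed_simplex (node Th) K y -> v y = affine c g y.
Proof.
move=> [/subspace_continuousP vcont vaff _] KT; have [c [g vE]] := vaff K KT.
exists c, g => y yK.
have [z zK] := barycenter_open_simplex (node Th) (card_cell KT).
have yz : (t *: (z - y) + y) @[t --> (0:R)^'+] --> y := @cvg_segment R d y z.
have segK : \forall t \near (0:R)^'+,
    open_simplex (node Th) K (t *: (z - y) + y).
  near=> t; apply: open_simplex_segment => //.
  by near: t; apply: nbhs_right_le.
have vy : v (t *: (z - y) + y) @[t --> (0:R)^'+] --> v y.
  have yO : closure Omega y by exact: closed_simplex_closure yK.
  apply: (cvg_trans _ (vcont y yO)) => U /= /yz; rewrite /nbhs/=.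
  apply: filter_app; move: segK; apply: filterS => t tK; apply.
  by apply: closed_simplex_closure KT _ _; exact: open_simplex_subset.
have ay : affine c g (t *: (z - y) + y) @[t --> (0:R)^'+] --> affine c g y.
  exact: (cvg_comp _ _ yz (@continuous_affine R d c g y)).
apply: (cvg_unique (@norm_hausdorff _ _) vy).
apply: cvg_trans ay; apply: near_eq_cvg.
by move: segK; apply: filterS => t /vE.
Unshelve. all: by end_near. Qed.

Lemma gradient_open_simplex v K c g y : K \in cells Th ->
  (forall z, open_simplex (node Th) K z -> v z = affine c g z) ->
  open_simplex (node Th) K y -> gradient Th v y = g.
Proof.
move=> KT vE yK; rewrite /gradient ifT; last by rewrite inE; exists K.
apply/rowP => k; rewrite mxE (@derive_affine_near _ _ _ _ _ c g).
  exact: sum_mul_delta.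
have : nbhs y (open_simplex (node Th) K).
  apply: open_nbhs_nbhs; split=> //; apply: open_open_simplex.
    exact: card_cell.
  exact: cell_nondegenerate.
exact: (@filterS _ _ (nbhs_filter y)).
Qed.

Lemma gradient_outside v y :
  ~ (\bigcup_(K in [set` cells Th]) open_simplex (node Th) K) y ->
  gradient Th v y = 0.
Proof.
by move=> yK; rewrite /gradient ifF//; apply/negbTE; rewrite notin_setE.
Qed.

Lemma gradient_P1 v : P1_space Th v ->
  exists G : {set 'I_(nb_nodes Th)} -> 'rV[R]_d, forall K y, K \in cells Th ->
    open_simplex (node Th) K y -> gradient Th v y = G K.
Proof.
move=> vP1.
have H (K : {set 'I_(nb_nodes Th)}) : exists g : 'rV[R]_d, K \in cells Th ->
    forall y, open_simplex (node Th) K y -> gradient Th v y = g.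
  have [KT|KT] := boolP (K \in cells Th); last by exists 0.
  have [c [g cg]] := P1_affine vP1 KT.
  exists g => _ y yK; apply: gradient_open_simplex KT _ yK => z zK.
  by apply: cg; exact: open_simplex_subset.
have [G GE] := choice H.
by exists G => K y KT yK; exact: GE.
Qed.

Lemma node_closure_star (K : {set 'I_(nb_nodes Th)}) (i j : 'I_(nb_nodes Th)) :
  K \in cells Th -> i \in K -> j \in K -> closure (star i) (node Th j).
Proof.
move=> KT iK jK.
have cK l : l \in K -> closure (open_simplex (node Th) K) (node Th l).
  move=> lK; apply: closed_simplex_subset; first exact: card_cell.
  exact: vertex_closed_simplex.
apply: closure_subset (cK j jK) => y yK.
by exists K => //; split=> //; exact: cK.
Qed.

(** The hat functions are prescribed at the nodes in Omega only; the remaining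
nodes lie on its boundary, where P1 functions vanish. *)
Lemma nodal_basis_node N (dof : 'I_N -> 'I_(nb_nodes Th))
    (phi : 'I_N -> 'rV[R]_d -> R) : dof_numbering dof -> nodal_basis dof phi ->
  forall i w, phi i (node Th w) = (w == dof i)%:R.
Proof.
move=> [dof_inj dofE] phiE i w; have [[_ _ phi0] phi1] := phiE i.
have [[l <-]|wO] := pselect (exists l, dof l = w).
  by rewrite phi1 (inj_eq dof_inj) eq_sym.
have [->|_] := eqVneq w (dof i); first by rewrite phi1 eqxx.
apply: phi0; last by move=> /dofE.
have [K KT wK] := node_in_cell w.
exact: closed_simplex_closure KT _ (vertex_closed_simplex _ wK).
Qed.

End P1_functions.

(** * The discrete obstacle problem on the unit cube *)

Section unit_cube_mesh.
Context (R : realType) (d : nat) (Th : mesh (@unit_cube R d)).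
Local Notation mu := (lebesgue_tuple R d).
Local Notation D := (@rv_of_tuple R d @^-1` @unit_cube R d).
Local Notation node := (node Th).
Local Notation S := (open_simplex node).

(** An element is only known to lie in the closed cube; an open subset of the
closed cube avoids its faces, since around each of its points it contains a
short segment in both directions of every axis. *)
Lemma open_simplex_unit_cube (K : {set 'I_(nb_nodes Th)}) : K \in cells Th ->
  S K `<=` @unit_cube R d.
Proof.
move=> KT y yK k.
have /nbhs_ballP[e /= e0 eS] : nbhs y (S K).
  apply: open_nbhs_nbhs; split=> //; apply: open_open_simplex.
    exact: card_cell.
  exact: cell_nondegenerate.
have bnd h : `|h| < e -> 0 <= h + y 0 k <= 1.
  move=> he; have /closure_unit_cube/(_ k) : closure (@unit_cube R d)
      (h *: delta_mx 0 k + y).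
    apply: closed_simplex_closure KT _ _; apply: open_simplex_subset.
    apply: eS; split=> // i j; rewrite /ball/= !mxE.
    rewrite opprD addrCA subrr addr0 normrN.
    by case: andP => _; rewrite ?mulr1// mulr0 normr0.
  by rewrite !mxE !eqxx mulr1.
have he : `|e / 2| < e.
  by rewrite gtr0_norm ?divr_gt0// gtr_pMr// invf_lt1// ltr1n.
have /andP[h1 h2] := bnd _ he.
have := he; rewrite -normrN => /bnd /andP[h3 h4].
by apply/andP; split; lra.
Qed.

(** No null set has to be discarded: F is prescribed to vanish off the open
elements, as gradients of P1 functions do by convention. *)
Lemma integrable_piecewise_cst (F : 'rV[R]_d -> R)
    (V : {set 'I_(nb_nodes Th)} -> R) :
  (forall K y, K \in cells Th -> S K y -> F y = V K) ->
  (forall y, ~ (\bigcup_(K in [set` cells Th]) S K) y -> F y = 0) ->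
  mu.-integrable D (EFin \o (fun t => F (rv_of_tuple t))).
Proof.
move=> FV F0.
pose U : set (d.-tuple (measurableTypeR R)) :=
  \bigcup_(K in [set` cells Th]) (@rv_of_tuple R d @^-1` S K).
have mS K : K \in cells Th -> measurable (@rv_of_tuple R d @^-1` S K).
  move=> KT; apply: measurable_open_simplex; first exact: card_cell.
  exact: cell_nondegenerate.
have mU : measurable U by apply: fin_bigcup_measurable.
have mD := @measurable_unit_cube R d.
have muD : (mu D < +oo)%E by rewrite lebesgue_unit_cube ltry.
apply: (measurable_bounded_integrable mD muD).
- rewrite -(setUIDK D U); apply/measurable_funU.
  + exact: measurableI.
  + exact: measurableD.
  split.
    apply: (measurable_fun_cover (P := cells Th)
      (C := fun K => @rv_of_tuple R d @^-1` S K)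
      (F := fun K => cst (V K))) => //.
    by move=> K t KT tK; rewrite (FV K).
  have m0 : measurable_fun (D `\` U)
    ((fun=> 0) : d.-tuple (measurableTypeR R) -> R) by exact: measurable_cst.
  apply: eq_measurable_fun m0.
  by move=> t /set_mem [_ tU]; rewrite /= F0.
- exists (\sum_(K in cells Th) `|V K|); split; first exact: num_real.
  move=> r Vr t _; apply: le_trans (ltW Vr).
  have [[K KT tK]|/F0 ->] := pselect ((\bigcup_(K in [set` cells Th]) S K)
    (rv_of_tuple t)).
    rewrite (FV K)// (bigD1 K)//= lerDl.
    by apply: sumr_ge0 => L _; exact: normr_ge0.
  by rewrite normr0; apply: sumr_ge0 => L _; exact: normr_ge0.
Qed.

Section nodal_basis.
Context (N : nat) (dof : 'I_N -> 'I_(nb_nodes Th))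
  (phi : 'I_N -> 'rV[R]_d -> R).
Hypotheses (hdof : dof_numbering dof) (hphi : nodal_basis dof phi).

(** By linearity of the integral the left-hand side is the integral of
grad (phi i) . grad w for w = \sum_j u j 0 *: phi j.  On an element containing
the node of i, w equals s at all vertices, hence is constant; on the other
elements phi i vanishes at all vertices, hence identically. *)
Lemma stiffness_row_cst (u : 'cV[R]_N) (s : R) (i : 'I_N) :
  (forall K w, K \in cells Th -> dof i \in K -> w \in K ->
     exists2 l, dof l = w & u l 0 = s) ->
  (stiffness Th phi *m u) i 0 = 0.
Proof.
move=> us; rewrite mxE.
pose F j y := \sum_k gradient Th (phi i) y 0 k * gradient Th (phi j) y 0 k.
have mD := @measurable_unit_cube R d.
have IF j : mu.-integrable D (EFin \o (fun t => F j (rv_of_tuple t))).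
  have [Gi GiE] := gradient_P1 (hphi i).1.
  have [Gj GjE] := gradient_P1 (hphi j).1.
  apply: (@integrable_piecewise_cst _ (fun K => \sum_k Gi K 0 k * Gj K 0 k)).
    by move=> K y KT yK; rewrite /F (GiE K)// (GjE K).
  move=> y yK; rewrite /F big1// => k _.
  by rewrite gradient_outside// mxE mul0r.
have -> : \sum_j stiffness Th phi i j * u j 0 =
    \int[mu]_(t in D) (\sum_j u j 0 * F j (rv_of_tuple t)).
  rewrite Rintegral_sum//; last first.
    move=> j; have := integrableZl mD (u j 0) (IF j).
    by congr (integrable _ _ _); apply/funext => t /=; rewrite EFinM.
  by apply: eq_bigr => j _; rewrite mxE mulrC RintegralZl.
rewrite (_ : (fun t => \sum_j u j 0 * F j (rv_of_tuple t)) = cst 0).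
  by rewrite Rintegral_cst// mul0r.
apply/funext => t /=; set y := rv_of_tuple t.
have [[K /= KT yK]|yK] :=
    pselect ((\bigcup_(K in [set` cells Th]) S K) y); last first.
  rewrite big1// => j _; rewrite /F big1 ?mulr0// => k _.
  by rewrite gradient_outside// mxE mul0r.
have cgE j : exists cg : R * 'rV[R]_d, forall z, closed_simplex node K z ->
    phi j z = affine cg.1 cg.2 z.
  by have [c [g cg]] := P1_affine (hphi j).1 KT; exists (c, g).
have [cg {}cgE] := choice cgE.
have gE j : gradient Th (phi j) y = (cg j).2.
  apply: gradient_open_simplex KT _ yK => z zK.
  by apply: cgE; exact: open_simplex_subset.
have phi_node j w : w \in K ->
    affine (cg j).1 (cg j).2 (node w) = (w == dof j)%:R.
  move=> wK; rewrite -cgE; last exact: vertex_closed_simplex.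
  exact: nodal_basis_node.
have slope0 c s' g : (forall w, w \in K -> affine c g (node w) = s') -> g = 0.
  apply: affine_cst_vertices; first exact: card_cell.
  exact: cell_nondegenerate.
have [iK|iK] := boolP (dof i \in K); last first.
  rewrite big1// => j _; rewrite /F gE (slope0 (cg i).1 0 (cg i).2).
    by rewrite big1 ?mulr0// => k _; rewrite mxE mul0r.
  move=> w wK; rewrite phi_node//; case: eqP => // wi.
  by move: iK; rewrite -wi wK.
(* The left-hand side is the slope on K of the combination w of the hat
   functions, which takes the value s at each vertex. *)
have gsum : \sum_j u j 0 *: (cg j).2 = 0.
  apply: (slope0 (\sum_j u j 0 * (cg j).1) s) => w wK.
  have [l lw ul] := us K w KT iK wK.
  transitivity (\sum_j u j 0 * affine (cg j).1 (cg j).2 (node w)).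
    rewrite /affine; under [RHS]eq_bigr do rewrite mulrDr.
    rewrite big_split/=; congr (_ + _).
    under [RHS]eq_bigr do rewrite mulr_sumr.
    rewrite exchange_big/=; apply: eq_bigr => k _.
    by rewrite summxE mulr_suml; apply: eq_bigr => j _; rewrite mxE mulrA.
  rewrite (bigD1 l)//= phi_node// lw eqxx mulr1 ul big1 ?addr0// => j jl.
  rewrite phi_node// -lw (inj_eq hdof.1) eq_sym (negbTE jl).
  by rewrite mulr0.
transitivity (\sum_k (cg i).2 0 k * (\sum_j u j 0 *: (cg j).2) 0 k).
  under eq_bigr do rewrite /F mulr_sumr.
  rewrite exchange_big/=; apply: eq_bigr => k _.
  rewrite summxE mulr_sumr; apply: eq_bigr => j _.
  by rewrite !gE mxE mulrCA.
by rewrite gsum big1// => k _; rewrite mxE mulr0.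
Qed.

(** On an element, phi i is the barycentric coordinate of the node of i, or 0 if
that node is not a vertex: it takes values in [0, 1] and is positive at a point
z inside some element.  It stays above half its value at z on a box around z,
which bounds the integral from below. *)
Lemma load_gt0 (a : R) (i : 'I_N) : 0 < a ->
  0 < load (@unit_cube R d) (fun=> a) phi i 0.
Proof.
move=> a0; rewrite mxE /integral_rv.
have mD := @measurable_unit_cube R d.
have cgE K : exists cg : R * 'rV[R]_d, K \in cells Th ->
    forall z, closed_simplex node K z -> phi i z = affine cg.1 cg.2 z.
  have [KT|_] := boolP (K \in cells Th); last by exists (0, 0).
  by have [c [g cg]] := P1_affine (hphi i).1 KT; exists (c, g).
have [cg {}cgE] := choice cgE.
have phi_comb K b : K \in cells Th -> (forall w, w \in K -> 0 <= b w) ->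
    \sum_(w in K) b w = 1 ->
    phi i (\sum_(w in K) b w *: node w) = \sum_(w in K) b w * (w == dof i)%:R.
  move=> KT b0 b1; rewrite (cgE K)//; last by exists b.
  rewrite affine_comb//; apply: eq_bigr => w wK; congr (_ * _).
  rewrite -(nodal_basis_node hdof hphi) -cgE//.
  exact: vertex_closed_simplex.
have cover y : @unit_cube R d y -> exists2 K, K \in cells Th &
    closed_simplex node K y.
  move=> /subset_closure; rewrite (cells_cover Th) => -[K KT yK].
  by exists K.
have phi01 y : @unit_cube R d y -> 0 <= phi i y <= 1.
  move=> /cover[K KT [b [b0 b1 ->]]]; rewrite phi_comb//; apply/andP; split.
    by apply: sumr_ge0 => w wK; rewrite mulr_ge0// b0.
  rewrite -[leRHS]b1; apply: ler_sum => w wK.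
  by have [_|_] := eqVneq w (dof i); [rewrite mulr1|rewrite mulr0 b0].
have mphi : measurable_fun D (fun t => a * phi i (rv_of_tuple t)).
  apply: measurable_realfun.measurable_funM; first exact: measurable_cst.
  apply: (measurable_fun_cover (P := cells Th)
    (C := fun K => @rv_of_tuple R d @^-1` closed_simplex node K)
    (F := fun K t => affine (cg K).1 (cg K).2 (rv_of_tuple t))).
  - move=> K KT; apply: measurable_closed_simplex; first exact: card_cell.
    exact: cell_nondegenerate.
  - by move=> K KT; exact: measurable_affine.
  - by move=> K t KT /= tK; rewrite (cgE K).
  - by move=> t /cover[K KT tK]; exists K.
have int_fin : (\int[mu]_(t in D) (a * phi i (rv_of_tuple t))%:E < +oo)%E.
  apply: integrable_lty => //; apply: (measurable_bounded_integrable mD) => //.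
    by rewrite [X in (X < _)%E]lebesgue_unit_cube ltry.
  exists a; split; first exact: num_real.
  move=> r ar t /phi01/andP[p0 p1]; rewrite /= ger0_norm; last first.
    by rewrite mulr_ge0// ltW.
  by apply: le_trans (ltW ar); rewrite ler_piMr// ltW.
apply: fine_gt0; rewrite int_fin andbT.
have [K KT iK] := node_in_cell (dof i).
have [z zK] := barycenter_open_simplex node (card_cell KT).
have phiz : 0 < phi i z.
  case: zK => b [b0 b1 ->]; rewrite phi_comb//; last by move=> w /b0/ltW.
  rewrite (bigD1 (dof i))//= eqxx mulr1 big1 ?addr0 ?b0//.
  by move=> w /andP[_ /negbTE ->]; rewrite mulr0.
(* Any value in the open interval from 0 to phi i z would do. *)
pose q := phi i z / 2.
have q0 : 0 < q by rewrite divr_gt0.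
have nz : nbhs z (S K `&` [set y | q < phi i y]).
  have nS : nbhs z (S K).
    apply: open_nbhs_nbhs; split=> //; apply: open_open_simplex.
      exact: card_cell.
    exact: cell_nondegenerate.
  have zE := cgE K KT z (open_simplex_subset zK).
  have := cvgr_gt _ (@continuous_affine R d (cg K).1 (cg K).2 z) q.
  rewrite -zE ltr_pdivrMr// ltr_pMr// ltr1n => /(_ (nbhs_filter z) isT) qz.
  apply: (@filterS2 _ _ (nbhs_filter z) _ _ _ _ nS qz) => y yK qy.
  split=> //=; rewrite (cgE K)//; exact: open_simplex_subset.
have [B [mB BU Boo] B0] := nbhs_box nz.
have BD : B `<=` D by move=> t /BU[/(open_simplex_unit_cube KT)].
apply: (@lt_le_trans _ _ (\int[mu]_(t in B) (a * q)%:E)%E).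
  by rewrite integral_cst// mule_gt0// lte_fin mulr_gt0.
apply: (@le_trans _ _ (\int[mu]_(t in B) (a * phi i (rv_of_tuple t))%:E)%E).
  apply: ge0_le_integral => //.
  - by move=> t _; rewrite lee_fin mulr_ge0// ltW.
  - apply/measurable_realfun.measurable_EFinP.
    exact: measurable_funS mD BD mphi.
  - by move=> t /BU[_ /= qt]; rewrite lee_fin ler_wpM2l// ltW.
apply: ge0_subset_integral => //.
- exact/measurable_realfun.measurable_EFinP.
- by move=> t /phi01/andP[p0 _]; rewrite lee_fin mulr_ge0// ltW.
Qed.

End nodal_basis.
End unit_cube_mesh.

Theorem theorem6p2 (R : realType) (d : nat) (hd : (1 <= d <= 3)%N)
  (Th : mesh (@unit_cube R d))
  (N : nat) (dof : 'I_N -> 'I_(nb_nodes Th)) (hdof : dof_numbering dof)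
  (phi : 'I_N -> 'rV[R]_d -> R) (hphi : nodal_basis dof phi)
  (u0 : 'cV[R]_N) (u lam : nat -> 'cV[R]_N) (Act : nat -> {set 'I_N})
  (hHIK : HIK_iterates (stiffness Th phi)
     (load (@unit_cube R d) (fun=> 20) phi)
     (obstacle_coefs (fun=> 1) dof) u0 u lam Act)
  (k : nat) (i : 'I_N) (hi : strict_interior dof (Act k) i) :
  i \in Act k.+1.
Proof.
case: hHIK => _ _ _ /(_ k) [Aub uact _ ->].
have {}uact l : l \in Act k -> u k.+1 l 0 = 1 by move=> /uact ->; rewrite mxE.
have iAct : i \in Act k.
  have [K KT iK] := node_in_cell (dof i).
  by have [l lAct /hdof.1 <-] := hi _ (node_closure_star KT iK iK).
have Au0 : (stiffness Th phi *m u k.+1) i 0 = 0.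
  apply: (stiffness_row_cst hdof hphi (s := 1)) => K w KT iK wK.
  have [l /uact ul lw] := hi _ (node_closure_star KT iK wK).
  by exists l.
have lamE : lam k.+1 i 0 = load (@unit_cube R d) (fun=> 20) phi i 0.
  by rewrite -Aub [RHS]mxE Au0 add0r.
by rewrite inE uact// mxE addrK lamE (load_gt0 hdof hphi).
Qed.
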